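(* Consider the involutive sandwich pair $\big(\mathrm{MRo}_{\alpha,\beta,\gamma}(n),\mathrm{MRo}_1(n)\big)$, where $\mathbb K=\overline{\mathbb K}$ is algebraically closed and $\mathrm{char}(\mathbb K)$ divides neither $2$ nor $r$ (e.g. $\mathrm{char}(\mathbb K)=0$). For $\lambda\in\mathcal P^{ap}$ and a simple $\mathscr H_\lambda$-module $V$, the dimension of the associated simple $\mathrm{MRo}_{\alpha,\beta,\gamma}(n)$-module $L(\lambda,V)$ is $$\dim_{\mathbb K}L(\lambda,V)=\mathrm{rank}_{\mathbb K}(\mathrm G^\lambda)\cdot\dim_{\mathbb K}(V)=\mathrm{rank}_{\mathbb K}(\mathrm G^\lambda).$$
   Context: Parameters. Fix a positive odd integer $r$ and $p_\alpha,p_\beta,p_\gamma\in\mathbb K[T]$, put $K=\max(\deg p_\alpha+1,r)$ and assume $\deg p_\beta,\deg p_\gamma<K$. Write $p_\alpha(T)/(1-T^r)=\sum_{k\ge0}\alpha_kT^k$, and similarly define $\beta_k,\gamma_k$ from $p_\beta,p_\gamma$. Let $\mathcal M=\langle a,b\mid ab=ba,\ ab=b^3,\ a^K=a^{K-r}\rangle$ (a monoid). The algebra. $\mathrm{MRo}_1(n)$ is the set of decorated rook diagrams: set partitions of $\{1,\dots,n\}\cup\{1',\dots,n'\}$ (unprimed points at the bottom, primed at the top) in which each block has at most one bottom and at most one top point, with every block carrying a number $g\in\{0,\dots,K-1\}$ of handle dots and a number $c\in\{0,1,2\}$ of Möbius dots. The composition $x\circ y$ stacks $x$ on top of $y$;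 when blocks are joined, the numbers $g$ and the numbers $c$ are added, after which one applies $(g,c)\mapsto(g+1,c-2)$ while $c\ge3$ and $(g,c)\mapsto(g-r,c)$ while $g\ge K$. A closed component with data $(g,c)$ is removed and replaced by the scalar $\alpha_g$ if $c=0$, $\beta_g$ if $c=1$, $\gamma_g$ if $c=2$. $\mathrm{MRo}_{\alpha,\beta,\gamma}(n)$ is the $\mathbb K$-algebra with basis $\mathrm{MRo}_1(n)$ and multiplication $\circ$. Cell structure. A through strand is a block with both a bottom and a top point. A diagram with $\lambda$ through strands is determined by its top (the positions of the through strands at the top and the dots on the top-only blocks), its bottom (the analogous bottom data), and its middle, an element of $\mathcal M\wr S_\lambda$ recording the permutation of, and the dots on, the through strands. The sandwiched algebra is $\mathscr H_\lambda=\mathbb K[\mathcal M\wr S_\lambda]$. The right cells $\mathcal R_\lambda$ (left cells $\mathcal L_\lambda$) with $\lambda$ through strands are indexed by the tops (bottoms), and $\mathcal H_{ij}$ is the set of diagrams with $\lambda$ through strands, top $i$ and bottom $j$. Gram matrix. $\mathrm G^\lambda$ is the $(\#\mathcal R_\lambda)\times(\#\mathcal L_\lambda)$-matrix over $\mathbb K$, rows indexed by tops $i$ and columns by bottoms $j$, with $(\mathrm G^\lambda)_{i,j}=s(e)$ if there exists $e\in\mathcal H_{ij}$ with $e^2=s(e)\cdot e$, $s(e)\in\mathbb K\setminus\{0\}$ (such an $e$ is then unique), and $(\mathrm G^\lambda)_{i,j}=0$ otherwise. Simple modules. A simple module has apex $\lambda$ if $\lambda$ is the smallest integer such that the span of the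 diagrams with exactly $\lambda$ through strands does not annihilate it; $\mathcal P^{ap}$ is the set of all apexes. For $\lambda\in\mathcal P^{ap}$, isomorphism classes of simple modules with apex $\lambda$ are in bijection with isomorphism classes of simple $\mathscr H_\lambda$-modules ($H$-reduction); $L(\lambda,V)$ denotes the simple module corresponding to $V$, i.e. the simple quotient with apex $\lambda$ of $\Delta(\lambda)\otimes_{\mathscr H_\lambda}V$, where $\Delta(\lambda)$ is the left cell module with basis the pairs (top, middle) with $\lambda$ through strands, the action being composition of diagrams modulo diagrams with fewer than $\lambda$ through strands.
   Formalization: The first equality is stated in full; the last, dim L(λ,V) = rank(G^λ), is stated only when λ ≤ 1 or dim V = 1, since it fails otherwise (e.g. n = λ = 2 and V induced from two distinct characters of M, of dimension 2, while rank G^2 = 1). *)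

(* Defs.v *)
(* MathComp. *)
From HB Require Import structures.
From mathcomp Require Import all_boot all_order all_fingroup all_algebra.

Set Implicit Arguments.
Unset Strict Implicit.
Unset Printing Implicit Defensive.

Import GRing.Theory.
Local Open Scope ring_scope.

(** * Algebras given by a basis with monomial structure constants *)

Section BasedAlgebra.
Variables (F : fieldType) (B : finType) (one : B) (comp : B -> B -> F * B).

(* The vector space with basis B; [comp x y = (s, z)] stands for the product
   rule x * y = s z of basis elements. *)
Definition balg := {ffun B -> F^o}.

Definition bvec (x : B) : balg := [ffun z => (z == x)%:R].

Definition bmul (u v : balg) : balg :=
  \sum_(x : B) \sum_(y : B) (u x * v y * (comp x y).1) *: bvec (comp x y).2.

(* Finite dimensional left modules.  All simple modules of a finite dimensional
   algebra are of this kind. *)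
Record bmodule (V : vectType F) := BModule {
  bact :> {linear {ffun B -> F^o} -> 'End(V)};
  bact1 : bact (bvec one) = \1%VF;
  bactM : forall u v : balg, bact (bmul u v) = (bact u \o bact v)%VF
}.

Definition bsubmodule (V : vectType F) (rV : bmodule V) (U : {vspace V}) :=
  forall u : balg, (rV u @: U <= U)%VS.

Definition bsimple (V : vectType F) (rV : bmodule V) :=
  \dim {:V} <> 0%N /\
  forall U : {vspace V}, bsubmodule rV U -> U = 0%VS \/ U = fullv.

End BasedAlgebra.

(** * Dots *)

Section Dots.
Variables (k r : nat).

(* The pair (g, c) is the element a^g b^c of the monoid
   < a, b | ab = ba, ab = b^3, a^K = a^(K - r) >, where K = k.+1; these pairs
   are its normal forms. *)
Definition dot := ('I_k.+1 * 'I_3)%type.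

Definition dot0 : dot := (ord0, ord0).

Definition dstep (gc : nat * nat) : nat * nat :=
  if (3 <= gc.2)%N then (gc.1.+1, gc.2 - 2)%N
  else if (k.+1 <= gc.1)%N then (gc.1 - r, gc.2)%N
  else gc.

(* For r > 0 every proper step decreases g + c, so that g + c iterations reach
   the normal form. *)
Definition dred (gc : nat * nat) : nat * nat := iter (gc.1 + gc.2) dstep gc.

Definition dadd (d e : dot) : dot :=
  let gc := dred (d.1 + e.1, d.2 + e.2)%N in (inord gc.1, inord gc.2).

(** ** The wreath product of the dot monoid with the symmetric group *)

(* [(d, s)] is the diagram joining the bottom point i to the top point [s i] by a
   strand with dots [d i]. *)
Definition wreath (l : nat) := ({ffun 'I_l -> dot} * 'S_l)%type.

Definition wone (l : nat) : wreath l := ([ffun=> dot0], 1%g).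

(* [wmul h h'] has h on top of h'; permutations compose left to right in
   MathComp, hence the order of the second components. *)
Definition wmul (l : nat) (h h' : wreath l) : wreath l :=
  ([ffun i => dadd (h'.1 i) (h.1 (h'.2 i))], (h'.2 * h.2)%g).

(** * Decorated rook diagrams *)

(* A block: its bottom point (if any), its top point (if any), its dots.  The
   composition below needs diagrams with m bottom points and n top points. *)
Definition block (m n : nat) :=
  (option 'I_m * option 'I_n * dot)%type.

Definition is_diag (m n : nat) (x : {set block m n}) : bool :=
  [&& [forall i : 'I_m, #|[set b in x | b.1.1 == Some i]| == 1%N],
      [forall j : 'I_n, #|[set b in x | b.1.2 == Some j]| == 1%N] &
      [forall b in x, b.1 != (None, None)]].

(* x on top of y *)
Definition bcomp (m n p : nat) (x : {set block n p}) (y : {set block m n}) :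
    {set block m p} :=
  [set b : block m p | let: (i, j, d) := b in
    [|| (j == None) && ((i, None, d) \in y),
        (i == None) && ((None, j, d) \in x) |
        ((i, j) != (None, None)) &&
        [exists q : 'I_n, exists d1 : dot, exists d2 : dot,
          [&& (i, Some q, d1) \in y, (Some q, j, d2) \in x & d == dadd d1 d2]]]].

Definition bid (n : nat) : {set block n n} :=
  [set (Some i, Some i, dot0) | i : 'I_n].

Lemma is_diagP (m n : nat) (x : {set block m n}) :
  reflect
    [/\ forall i, exists o d, forall o' d',
          ((Some i, o', d') \in x) = ((o', d') == (o, d)),
        forall j, exists o d, forall o' d',
          ((o', Some j, d') \in x) = ((o', d') == (o, d)) &
        forall d, (None, None, d) \notin x]
    (is_diag x).
Proof.
apply: (iffP and3P) => [[/forallP Hb /forallP Ht /forallP Hn]|[Hb Ht Hn]].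
- split=> [i|j|d].
  + have /cards1P[[[a o] d] E] := Hb i.
    exists o, d => o' d'; have /setP/(_ (Some i, o', d')) := E.
    rewrite !inE /= eqxx andbT => ->.
    have : (a, o, d) \in [set b in x | b.1.1 == Some i] by rewrite E set11.
    by rewrite inE /= => /andP[_ /eqP->]; rewrite !xpair_eqE eqxx.
  + have /cards1P[[[o a] d] E] := Ht j.
    exists o, d => o' d'; have /setP/(_ (o', Some j, d')) := E.
    rewrite !inE /= eqxx andbT => ->.
    have : (o, a, d) \in [set b in x | b.1.2 == Some j] by rewrite E set11.
    by rewrite inE /= => /andP[_ /eqP->]; rewrite !xpair_eqE eqxx andbT.
  + by apply/negP => Hd; have /implyP/(_ Hd) := Hn (None, None, d).
- split.
  + apply/forallP => i; have [o [d E]] := Hb i.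
    apply/cards1P; exists (Some i, o, d); apply/setP => -[[a o'] d'].
    rewrite !inE /= !xpair_eqE; case: (a =P Some i) => [->|_]; last by rewrite andbF.
    by rewrite andbT E xpair_eqE.
  + apply/forallP => j; have [o [d E]] := Ht j.
    apply/cards1P; exists (o, Some j, d); apply/setP => -[[o' a] d'].
    rewrite !inE /= !xpair_eqE; case: (a =P Some j) => [->|_]; last by rewrite !andbF.
    by rewrite !andbT E xpair_eqE.
  + apply/forallP => -[[a b] d]; apply/implyP => Hx /=.
    apply/eqP => -[Ea Eb]; move: Hx; rewrite Ea Eb => Hx.
    by have := Hn d; rewrite Hx.
Qed.

Lemma bcomp_is_diag (m n p : nat) (x : {set block n p}) (y : {set block m n}) :
  is_diag x -> is_diag y -> is_diag (bcomp x y).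
Proof.
move=> /is_diagP[xb xt xn] /is_diagP[yb yt yn]; apply/is_diagP; split.
- move=> i; have [[q|] [d E]] := yb i; last first.
    exists None, d => o' d'; rewrite inE /= E.
    have -> : [exists q, exists d1, exists d2,
       [&& (Some i, Some q, d1) \in y, (Some q, o', d2) \in x & d' == dadd d1 d2]]
        = false.
      apply/existsP => -[q /existsP[d1 /existsP[d2 /and3P[]]]].
      by rewrite E !xpair_eqE.
    by rewrite ?andbF ?orbF !xpair_eqE; case: o'.
  have [o [e E']] := xb q.
  exists o, (dadd d e) => o' d'; rewrite inE /= E !xpair_eqE /= !andbF /=.
  apply/existsP/andP.
    move=> [q' /existsP[d1 /existsP[d2 /and3P[]]]].
    rewrite E => /eqP[-> ->]; rewrite E' => /eqP[-> ->] /eqP->.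
    by rewrite !eqxx.
  move=> [/eqP-> /eqP->]; exists q; apply/existsP; exists d; apply/existsP; exists e.
  by rewrite E E' !eqxx.
- move=> j; have [[q|] [d E]] := xt j; last first.
    exists None, d => o' d'; rewrite inE /= E.
    have -> : [exists q, exists d1, exists d2,
       [&& (o', Some q, d1) \in y, (Some q, Some j, d2) \in x & d' == dadd d1 d2]]
        = false.
      apply/existsP => -[q /existsP[d1 /existsP[d2 /and3P[_]]]].
      by rewrite E !xpair_eqE.
    by rewrite ?andbF ?orbF !xpair_eqE; case: o'.
  have [o [e E']] := yt q.
  exists o, (dadd e d) => o' d'; rewrite inE /= E !xpair_eqE /= !andbF /=.
  apply/existsP/andP.
    move=> [q' /existsP[d1 /existsP[d2 /and3P[H]]]].
    rewrite E => /eqP[Eq ->]; move: H; rewrite Eq E' => /eqP[-> ->] /eqP->.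
    by rewrite !eqxx.
  move=> [/eqP-> /eqP->]; exists q; apply/existsP; exists e; apply/existsP; exists d.
  by rewrite E E' !eqxx.
- by move=> d; rewrite inE /= (negPf (yn d)) (negPf (xn d)).
Qed.

Lemma bid_is_diag (n : nat) : is_diag (bid n).
Proof.
apply/is_diagP; split=> [i|j|d].
- exists (Some i), dot0 => o' d'; apply/imsetP/eqP => [[q _ [-> -> ->]] //|[-> ->]].
  by exists i.
- exists (Some j), dot0 => o' d'; apply/imsetP/eqP => [[q _ [-> -> ->]] //|[-> ->]].
  by exists j.
- by apply/imsetP => -[].
Qed.

Record diag (n : nat) := Diag { blocks :> {set block n n}; _ : is_diag blocks }.
HB.instance Definition _ (n : nat) := [isSub for @blocks n].
HB.instance Definition _ (n : nat) := [Finite of diag n by <:].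

Lemma blocks_is_diag (n : nat) (x : diag n) : is_diag x.
Proof. by case: x. Qed.

Definition diag_comp (n : nat) (x y : diag n) : diag n :=
  Diag (bcomp_is_diag (blocks_is_diag x) (blocks_is_diag y)).

Definition diag_id (n : nat) : diag n := Diag (bid_is_diag n).

(** ** Through strands, tops, bottoms *)

Definition through (n : nat) (x : diag n) : nat :=
  #|[set b in blocks x | (b.1.1 != None) && (b.1.2 != None)]|.

(* A point carrying a through strand is sent to [None]; any other point is sent to
   the dots of its block. *)
Definition dtop (n : nat) (x : diag n) : {ffun 'I_n -> option dot} :=
  [ffun j => [pick d | (None, Some j, d) \in blocks x]].

Definition dbot (n : nat) (x : diag n) : {ffun 'I_n -> option dot} :=
  [ffun i => [pick d | (Some i, None, d) \in blocks x]].

(* The possible tops, and equally the possible bottoms, of diagrams with l through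
   strands: they index the right cells and the left cells. *)
Definition half (n l : nat) :=
  {t : {ffun 'I_n -> option dot} | #|[set j | t j == None]| == l}.

(* The top t and the middle h assembled into the blocks of a diagram with l bottom
   and n top points: the strand from the bottom point i ends at the (h.2 i)-th
   through strand position of t, counted from the left. *)
Definition tm_blocks (n l : nat) (th : half n l * wreath l) :
    {set block l n} :=
  let t := val th.1 in let h := th.2 in
  [set b : block l n | match b with
     | (Some i, Some j, d) =>
         [&& t j == None, d == h.1 i &
             #|[set j' : 'I_n | (j' < j)%N && (t j' == None)]| == h.2 i]
     | (None, Some j, d) => t j == Some d
     | (_, None, _) => false
     end].

End Dots.

(** * The algebra *)

(* With deg 0 = 0, this is K - 1 where K = max(deg p_alpha + 1, r) (see [KpredE]);
   K is always used in the form [(Kpred r pa).+1]. *)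
Definition Kpred (F : fieldType) (r : nat) (pa : {poly F}) : nat :=
  maxn (size pa).-1 r.-1.

Lemma KpredE (F : fieldType) (r : nat) (pa : {poly F}) :
  (0 < r)%N -> (Kpred r pa).+1 = maxn (size pa).-1.+1 r.
Proof. by case: r => // r _; rewrite maxnSS. Qed.

(* The coefficient of T^i in the power series p / (1 - T^r) = p * sum_m T^(r m). *)
Definition pser (F : fieldType) (r : nat) (p : {poly F}) (i : nat) : F :=
  \sum_(j < i.+1 | (r %| i - j)%N) p`_j.

Section Algebra.
Variables (F : fieldType) (r : nat) (pa pb pg : {poly F}) (n : nat).
Local Notation k := (Kpred r pa).

Definition closed_value (d : dot k) : F :=
  if d.2 == 0 :> nat then pser r pa d.1
  else if d.2 == 1%N :> nat then pser r pb d.1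
  else pser r pg d.1.

(* The product of the values of the closed components of x on top of y; such a
   component consists of a top-only block of y and a bottom-only block of x. *)
Definition closed_scalar (m p : nat) (x : {set block k n p})
    (y : {set block k m n}) : F :=
  \prod_(q : 'I_n)
    \prod_(d : dot k | (None, Some q, d) \in y)
      \prod_(e : dot k | (Some q, None, e) \in x) closed_value (dadd r d e).

Definition mro_comp (x y : diag k n) : F * diag k n :=
  (closed_scalar x y, diag_comp r x y).

Definition mro_module := bmodule (diag_id k n) mro_comp.

Local Notation A := (balg F (diag k n)).

(** ** Apexes *)

(* The span of the diagrams with l through strands annihilates the module. *)
Definition annihilates (L : vectType F) (rL : mro_module L) (l : nat) :=
  forall u : A, (forall x, u x != 0 -> through x = l) -> rL u = 0.

Definition has_apex (L : vectType F) (rL : mro_module L) (l : nat) :=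
  ~ annihilates rL l /\ forall l', (l' < l)%N -> annihilates rL l'.

Definition is_apex (l : nat) :=
  exists (L : vectType F) (rL : mro_module L), bsimple rL /\ has_apex rL l.

(** ** The sandwiched algebra *)

Section Cell.
Variable l : nat.

Definition wr_comp (h h' : wreath k l) : F * wreath k l := (1, wmul r h h').

Definition sandwich_module := bmodule (wone k l) wr_comp.

(** ** The Gram matrix *)

(* The coefficient of e in e * e; it is s(e) when e * e is a multiple of e. *)
Definition sq_coef (e : diag k n) : F := bmul mro_comp (bvec F e) (bvec F e) e.

Definition pseudo_idem (e : diag k n) : bool :=
  (bmul mro_comp (bvec F e) (bvec F e) == sq_coef e *: bvec F e)
  && (sq_coef e != 0).

(* There may be several such e, differing by their middles, but they all have the
   same s(e): it is the product of the values of the closed components, which only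
   involve the top and the bottom. *)
Definition gram_entry (i j : half k n l) : F :=
  if [pick e : diag k n | [&& through e == l, dtop e == val i, dbot e == val j &
                              pseudo_idem e]]
  is Some e then sq_coef e else 0.

Definition gram : 'M[F]_(#|{: half k n l}|, #|{: half k n l}|) :=
  \matrix_(i, j) gram_entry (enum_val i) (enum_val j).

(** ** Simple modules from cell modules *)

Definition topmid := (half k n l * wreath k l)%type.

Definition tm_right (q : topmid) (h : wreath k l) : topmid :=
  (q.1, wmul r q.2 h).

(* The tensor product over F of the cell module, whose basis is [topmid], and V;
   [pure q v] is the tensor of the basis element q and v. *)
Definition cellV (V : vectType F) : vectType F := {ffun topmid -> V}.

Definition pure (V : vectType F) (q : topmid) (v : V) : cellV V :=
  [ffun q' => if q' == q then v else 0].

(* A diagram acts on a basis element q of the cell module by composition, the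
   result being 0 if the composite has fewer than l through strands, i.e. if it is
   not made of a top and a middle. *)
Definition cell_act (V : vectType F) (x : diag k n) (w : cellV V) : cellV V :=
  \sum_(q : topmid) closed_scalar x (tm_blocks q) *:
    \sum_(q' : topmid | tm_blocks q' == bcomp r x (tm_blocks q)) pure q' (w q).

(* Surjective module homomorphisms onto L from the tensor product, over the
   sandwiched algebra, of the cell module and V: the maps from the tensor product
   over F that are balanced, commute with the action and are onto. *)
Definition cell_onto (V : vectType F) (rV : sandwich_module V)
    (L : vectType F) (rL : mro_module L) (f : 'Hom(cellV V, L)) :=
  [/\ forall (q : topmid) (h : wreath k l) (v : V),
        f (pure (tm_right q h) v) = f (pure q (rV (bvec F h) v)),
      forall (x : diag k n) (w : cellV V),
        f (cell_act x w) = rL (bvec F x) (f w) &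
      limg f = fullv].

(* L is the simple module with apex l attached to V. *)
Definition is_simple_quotient (V : vectType F) (rV : sandwich_module V)
    (L : vectType F) (rL : mro_module L) :=
  [/\ bsimple rL, has_apex rL l & exists f, cell_onto rV rL f].

End Cell.
End Algebra.

(* Main.v *)
From HB Require Import structures.
Require Import Defs.
From mathcomp Require Import all_boot all_order all_fingroup all_algebra.
(* From here on [half] is the type of tops, not the halving of natural numbers. *)
Import Defs GRing.Theory.
Local Open Scope ring_scope.

Set Implicit Arguments.
Unset Strict Implicit.
Unset Printing Implicit Defensive.

(** Composing a diagram with bottom b and a diagram with top t, both with l
    through strands, either loses a through strand or creates a trivial middle:
    in rook diagrams each through strand position of b meets a single block of t.
    The sandwich form, which in general takes its values in the sandwiched algebra
    H, is therefore scalar.  Its value [cell_form t b] is the product of the values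
    of the closed components if the through strands of b and t meet, and 0
    otherwise.  It is the Gram matrix entry ([gram_entryE]), because,
    when the through strands meet, the diagram with top t, trivial middle and bottom b
    has this scalar as its square coefficient.

    The cell module is free over H on the tops, so that its tensor product with V
    over H is V^(tops), mapping onto L by [onto_top].  A diagram with top t, middle
    h and bottom b sends a family w to the family supported at t with value
    h (sum_t' cell_form t' b w_t') ([cell_act_top_tensor]).  By minimality of the
    apex, the vectors of L killed by all diagrams with l through strands form a
    proper submodule, hence 0 ([apex_faithful]); and as V is simple, a vector v of V
    such that t (x) h v vanishes in L for all t and h is 0 ([pure_faithful]).
    The kernel of the map from V^(tops) to L therefore consists of the families w
    with sum_t cell_form t b w_t = 0 for all b ([onto_top_ker]), and the quotient has
    dimension rank * dim V ([dim_quotient_rank]).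

    For l <= 1 the algebra H is commutative, so that its simple modules over an
    algebraically closed field have dimension 1 ([bsimple_comm_dim1]). *)

(** * Dots *)

Section Dots.
Variables (k r : nat).
Implicit Types d e : dot k.

Lemma dred_id (g c : nat) : (g < k.+1)%N -> (c < 3)%N -> dred k r (g, c) = (g, c).
Proof.
move=> gk c3; rewrite /dred; elim: (_ + _)%N => //= m ->.
by rewrite /dstep /= leqNgt c3 leqNgt gk.
Qed.

Lemma dadd0r d : dadd r d (dot0 k) = d.
Proof.
case: d => g c; rewrite /dadd /= !addn0 dred_id //=.
by rewrite !inord_val.
Qed.

Lemma dadd0l d : dadd r (dot0 k) d = d.
Proof. by case: d => g c; rewrite /dadd /= !add0n dred_id //= !inord_val. Qed.

Lemma daddC d e : dadd r d e = dadd r e d.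
Proof. by rewrite /dadd addnC [(d.2 + _)%N]addnC. Qed.

End Dots.

(** * Tops, bottoms and through strands of rectangular diagrams *)

Section Blocks.
Variable k : nat.

(** The dots of the top-only blocks of a rectangular diagram, and [None] at the top
    points of its through strands; [botf] is the same at the bottom.  On square
    diagrams these are convertible to [dtop] and [dbot]. *)
Definition topf m n (x : {set block k m n}) : {ffun 'I_n -> option (dot k)} :=
  [ffun j => [pick d | (None, Some j, d) \in x]].

Definition botf m n (x : {set block k m n}) : {ffun 'I_m -> option (dot k)} :=
  [ffun i => [pick d | (Some i, None, d) \in x]].

(** The points of a top, or of a bottom, that carry a through strand. *)
Definition strand_pts n (t : {ffun 'I_n -> option (dot k)}) : {set 'I_n} :=
  [set j | t j == None].

(** The reflection of a diagram in a horizontal axis. *)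
Definition flip m n (x : {set block k m n}) : {set block k n m} :=
  [set b | (b.1.2, b.1.1, b.2) \in x].

Lemma mem_flip m n (x : {set block k m n}) i j d :
  ((i, j, d) \in flip x) = ((j, i, d) \in x).
Proof. by rewrite inE. Qed.

Lemma flip_is_diag m n (x : {set block k m n}) : is_diag x -> is_diag (flip x).
Proof.
move=> /is_diagP[xb xt xn]; apply/is_diagP; split=> [i|j|d].
- by have [o [d E]] := xt i; exists o, d => o' d'; rewrite mem_flip.
- by have [o [d E]] := xb j; exists o, d => o' d'; rewrite mem_flip.
- by rewrite mem_flip.
Qed.

Lemma topf_flip m n (x : {set block k m n}) : topf (flip x) = botf x.
Proof. by apply/ffunP=> i; rewrite !ffunE; apply: eq_pick => d; rewrite mem_flip. Qed.

Section OneDiagram.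
Variables (m n : nat) (x : {set block k m n}).
Hypothesis xP : is_diag x.

Lemma diag_top_uniq j o d o' d' :
  (o, Some j, d) \in x -> (o', Some j, d') \in x -> o = o' /\ d = d'.
Proof.
have [_ xt _] := is_diagP _ xP; have [a [e E]] := xt j.
by rewrite !E => /eqP[-> ->] /eqP[-> ->].
Qed.

Lemma diag_bot_uniq i o d o' d' :
  (Some i, o, d) \in x -> (Some i, o', d') \in x -> o = o' /\ d = d'.
Proof.
have [xb _ _] := is_diagP _ xP; have [a [e E]] := xb i.
by rewrite !E => /eqP[-> ->] /eqP[-> ->].
Qed.

Lemma diag_nonempty d : ((None, None, d) \in x) = false.
Proof. by have [_ _ /(_ d)/negPf] := is_diagP _ xP. Qed.

Lemma mem_topf j d : ((None, Some j, d) \in x) = (topf x j == Some d).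
Proof.
rewrite ffunE; case: pickP => [e xe|xN]; last by rewrite xN.
apply/idP/eqP => [xd|[<-]//].
by have [_ ->] := diag_top_uniq xe xd.
Qed.

Lemma mem_botf i d : ((Some i, None, d) \in x) = (botf x i == Some d).
Proof.
rewrite ffunE; case: pickP => [e xe|xN]; last by rewrite xN.
apply/idP/eqP => [xd|[<-]//].
by have [_ ->] := diag_bot_uniq xe xd.
Qed.

Lemma topf_strandP j :
  reflect (exists i d, (Some i, Some j, d) \in x) (j \in strand_pts (topf x)).
Proof.
rewrite inE; apply: (iffP eqP) => [tj|[i [d xd]]].
  have [_ /(_ j)[[i|] [d E]] _] := is_diagP _ xP.
    by exists i, d; rewrite E.
  by have := E None d; rewrite eqxx mem_topf tj.
case tj: (topf x j) => [e|//].
by have := diag_top_uniq xd; move=> /(_ None e); rewrite mem_topf tj eqxx => /(_ isT)[].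
Qed.

Lemma botf_strandP i :
  reflect (exists j d, (Some i, Some j, d) \in x) (i \in strand_pts (botf x)).
Proof.
rewrite inE; apply: (iffP eqP) => [tj|[j [d xd]]].
  have [/(_ i)[[j|] [d E]] _ _] := is_diagP _ xP.
    by exists j, d; rewrite E.
  by have := E None d; rewrite eqxx mem_botf tj.
case tj: (botf x i) => [e|//].
by have := diag_bot_uniq xd; move=> /(_ None e); rewrite mem_botf tj eqxx => /(_ isT)[].
Qed.

(** The through strands. *)
Definition strands : {set block k m n} :=
  [set b in x | (b.1.1 != None) && (b.1.2 != None)].

Lemma card_strand_pts_topf : #|strand_pts (topf x)| = #|strands|.
Proof.
have inj: {in strands &, injective (fun b : block k m n => b.1.2)}.
  move=> [[i [j|]] d] [[i' j'] d']; rewrite !inE /= ?andbF //.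
  move=> /andP[xb _] /andP[xb' _] E.
  by move: xb'; rewrite -E => /(diag_top_uniq xb)[-> ->].
rewrite -(card_in_imset inj) -(card_imset (mem (strand_pts _)) (@Some_inj _)).
apply: eq_card => o; apply/imsetP/imsetP => [[j /topf_strandP[i [d xd]] ->]|[[[i j] d]]].
  by exists (Some i, Some j, d); rewrite // inE xd.
rewrite inE /=; case: i => [i|]; last by rewrite andbF.
case: j => [j|]; last by rewrite andbF.
rewrite !andbT => xd ->; exists j => //; apply/topf_strandP; by exists i, d.
Qed.

End OneDiagram.

Lemma card_strands_flip m n (x : {set block k m n}) : #|strands (flip x)| = #|strands x|.
Proof.
pose f (b : block k n m) : block k m n := (b.1.2, b.1.1, b.2).
have fI : injective f by move=> [[i j] d] [[i' j'] d'] [-> -> ->].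
rewrite -(card_imset _ fI); apply: eq_card => -[[i j] d].
apply/imsetP/idP => [[[[i' j'] d'] xd [-> -> ->]]|xd].
  by move: xd; rewrite !inE /= [X in _ && X]andbC.
by exists (j, i, d); move: xd; rewrite // !inE /= [X in _ && X]andbC.
Qed.

Lemma card_strand_pts_botf m n (x : {set block k m n}) :
  is_diag x -> #|strand_pts (botf x)| = #|strands x|.
Proof.
by move=> xP; rewrite -topf_flip card_strand_pts_topf ?flip_is_diag // card_strands_flip.
Qed.

Variable r : nat.

Lemma mem_bcomp m n p (x : {set block k n p}) (y : {set block k m n}) i j d :
  ((i, j, d) \in bcomp r x y) =
  [|| (j == None) && ((i, None, d) \in y), (i == None) && ((None, j, d) \in x) |
      ((i, j) != (None, None)) &&
      [exists q, exists d1, exists d2,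
        [&& (i, Some q, d1) \in y, (Some q, j, d2) \in x & d == dadd r d1 d2]]].
Proof. by rewrite inE. Qed.

Lemma mem_bcomp_strand m n p (x : {set block k n p}) (y : {set block k m n}) i j d :
  reflect (exists q d1 d2, [/\ (Some i, Some q, d1) \in y, (Some q, Some j, d2) \in x &
                               d = dadd r d1 d2])
          ((Some i, Some j, d) \in bcomp r x y).
Proof.
rewrite mem_bcomp /=; apply: (iffP existsP).
  by move=> [q /existsP[d1 /existsP[d2 /and3P[H1 H2 /eqP->]]]]; exists q, d1, d2.
move=> [q [d1 [d2 [H1 H2 ->]]]]; exists q; apply/existsP; exists d1.
by apply/existsP; exists d2; rewrite H1 H2 eqxx.
Qed.

Section TwoDiagrams.
Variables (m n p : nat) (x : {set block k n p}) (y : {set block k m n}).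
Hypotheses (xP : is_diag x) (yP : is_diag y).

Lemma strand_pts_bcomp : strand_pts (topf (bcomp r x y)) \subset strand_pts (topf x).
Proof.
apply/subsetP=> j /topf_strandP-/(_ (bcomp_is_diag r xP yP))[i [d]].
by move=> /mem_bcomp_strand[q [d1 [d2 [_ xq _]]]]; apply/topf_strandP=> //; exists q, d2.
Qed.

Lemma strands_bcomp_le : (#|strands (bcomp r x y)| <= #|strands x|)%N.
Proof.
rewrite -!card_strand_pts_topf ?bcomp_is_diag //.
exact: subset_leq_card strand_pts_bcomp.
Qed.

(** No through strand is lost exactly when those of the two factors meet. *)
Lemma strands_match l :
  #|strands x| = l -> #|strands y| = l -> #|strands (bcomp r x y)| = l ->
  strand_pts (botf x) = strand_pts (topf y).
Proof.
move=> xl yl xyl.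
have zP := bcomp_is_diag r xP yP.
have E : strand_pts (topf (bcomp r x y)) = strand_pts (topf x).
  by apply/eqP; rewrite eqEcard strand_pts_bcomp !card_strand_pts_topf // xl xyl /=.
apply/eqP; rewrite eqEcard card_strand_pts_botf // card_strand_pts_topf // xl yl.
rewrite leqnn andbT.
apply/subsetP=> q /botf_strandP-/(_ xP)[j [d xd]].
have : j \in strand_pts (topf x) by apply/topf_strandP=> //; exists q, d.
rewrite -E => /topf_strandP-/(_ zP)[i [d']].
move=> /mem_bcomp_strand[q' [d1 [d2 [yq xq _]]]].
have [[<-] _] := diag_top_uniq xP xq xd.
by apply/topf_strandP=> //; exists i, d1.
Qed.

End TwoDiagrams.

End Blocks.

(** * Tops with middles *)

Section Halves.
Variables (k n l : nat).
Implicit Types (t b : half k n l) (h : wreath k l).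

Lemma card_strand_pts_half t : #|strand_pts (val t)| = l.
Proof. exact/eqP/(valP t). Qed.

(** The number of elements of A to the left of j. *)
Definition rank_in (A : {set 'I_n}) (j : 'I_n) : nat :=
  #|[set j' : 'I_n | (j' < j)%N & j' \in A]|.

Lemma rank_in_lt (A : {set 'I_n}) j : j \in A -> (rank_in A j < #|A|)%N.
Proof.
move=> jA; apply/proper_card/properP; split.
  by apply/subsetP=> i; rewrite inE => /andP[].
by exists j; rewrite // inE ltnn.
Qed.

Lemma rank_in_inj (A : {set 'I_n}) : {in A &, injective (rank_in A)}.
Proof.
have lt (i j : 'I_n) : i \in A -> (i < j)%N -> (rank_in A i < rank_in A j)%N.
  move=> iA ij; apply/proper_card/properP; split.
    by apply/subsetP=> q; rewrite !inE => /andP[qi ->]; rewrite (ltn_trans qi ij).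
  by exists i; rewrite !inE ?ltnn // ij.
move=> i j iA jA E; case: (ltngtP i j) => [ij|ji|/ord_inj//].
  by have := lt i j iA ij; rewrite E ltnn.
by have := lt j i jA ji; rewrite E ltnn.
Qed.

Lemma pos_subproof t (c : 'I_l) :
  {j : 'I_n | (j \in strand_pts (val t)) && (rank_in (strand_pts (val t)) j == c)}.
Proof.
apply: sigW; set A := strand_pts _.
have cA : #|A| = l := card_strand_pts_half t.
have ltl j : j \in A -> (rank_in A j < l)%N.
  by rewrite -[l in (_ < l)%N]cA; apply: rank_in_lt.
have inj : {in A &, injective (fun j => insubd c (rank_in A j))}.
  move=> i j iA jA /(congr1 val); rewrite !val_insubd !ltl //.
  exact: rank_in_inj.
(* An injection between sets with l elements is onto. *)
have : [set insubd c (rank_in A j) | j in A] = setT.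
  by apply/eqP; rewrite eqEcard subsetT cardsT card_ord card_in_imset ?cA /=.
move=> /setP/(_ c); rewrite in_setT => /imsetP[j jA /(congr1 val)].
by rewrite val_insubd ltl // => E; exists j; rewrite jA E eqxx.
Qed.

(** The c-th point of a half diagram that carries a through strand. *)
Definition pos t c : 'I_n := sval (pos_subproof t c).

Lemma pos_strand t c : pos t c \in strand_pts (val t).
Proof. by rewrite /pos; case: pos_subproof => j /= /andP[]. Qed.

Lemma rank_pos t c : rank_in (strand_pts (val t)) (pos t c) = c.
Proof. by rewrite /pos; case: pos_subproof => j /= /andP[_ /eqP]. Qed.

Lemma posP t (c : 'I_l) j :
  (j \in strand_pts (val t)) && (rank_in (strand_pts (val t)) j == c) = (j == pos t c).
Proof.
apply/idP/eqP => [/andP[jA /eqP E]|->]; last by rewrite pos_strand rank_pos eqxx.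
by apply: rank_in_inj (pos_strand t c) _; rewrite // rank_pos.
Qed.

Lemma pos_inj t : injective (pos t).
Proof. by move=> c d E; apply/val_inj; rewrite /= -(rank_pos t c) E rank_pos. Qed.

Lemma strand_pts_pos t j : j \in strand_pts (val t) -> exists c, j = pos t c.
Proof.
move=> jA; have := rank_in_lt jA; rewrite card_strand_pts_half => lt.
by exists (Ordinal lt); apply/eqP; rewrite -posP jA /=.
Qed.

Lemma eq_pos t b : strand_pts (val t) = strand_pts (val b) -> pos t =1 pos b.
Proof. by move=> E c; apply/eqP; rewrite -posP -E posP. Qed.

Lemma mem_tm_strand t h i j d :
  ((Some i, Some j, d) \in tm_blocks (t, h)) = (j == pos t (h.2 i)) && (d == h.1 i).
Proof.
rewrite inE -posP [j \in _]inE -andbA; congr andb; rewrite andbC; congr andb.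
by congr eq_op; apply: eq_card => q; rewrite !inE.
Qed.

Lemma mem_tm_top t h j d :
  ((None, Some j, d) \in tm_blocks (t, h)) = (val t j == Some d).
Proof. by rewrite inE. Qed.

Lemma mem_tm_bot t h i d : ((i, None, d) \in tm_blocks (t, h)) = false.
Proof. by rewrite inE; case: i. Qed.

Lemma tm_is_diag t h : is_diag (tm_blocks (t, h)).
Proof.
apply/is_diagP; split=> [i|j|d].
- exists (Some (pos t (h.2 i))), (h.1 i) => -[j|] d.
    by rewrite mem_tm_strand.
  by rewrite mem_tm_bot.
- case tj: (val t j) => [e|].
    exists None, e => -[i|] d.
      rewrite mem_tm_strand; apply/andP=> -[/eqP E _].
      by have := pos_strand t (h.2 i); rewrite -E inE tj.
    by rewrite mem_tm_top tj xpair_eqE eqxx /= eq_sym.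
  have [c ->] : exists c, j = pos t c by apply: strand_pts_pos; rewrite inE tj.
  exists (Some (h.2^-1 c)%g), (h.1 (h.2^-1 c)%g) => -[i|] d.
    rewrite mem_tm_strand (inj_eq (@pos_inj t)) xpair_eqE.
    rewrite (inj_eq (@Some_inj _)) [c == _]eq_sym (can2_eq (permK h.2) (permKV h.2)).
    by case: eqP => // ->.
  rewrite mem_tm_top; have := pos_strand t c; by rewrite inE => /eqP->.
- by rewrite mem_tm_bot.
Qed.

Lemma topf_tm t h : topf (tm_blocks (t, h)) = val t.
Proof.
apply/ffunP=> j; rewrite ffunE; case: pickP => [d|tN].
  by rewrite mem_tm_top => /eqP.
case tj: (val t j) => [e|//].
by have := tN e; rewrite mem_tm_top tj eqxx.
Qed.

Lemma tm_blocks_inj : injective (@tm_blocks k n l).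
Proof.
move=> [t [h s]] [t' [h' s']] E.
have Et : t = t' by apply/val_inj; rewrite -(topf_tm t (h, s)) E topf_tm.
case: _ / Et in E *.
have H i : s i = s' i /\ h i = h' i.
  have := mem_tm_strand t (h, s) i (pos t (s i)) (h i).
  rewrite E mem_tm_strand /= !eqxx /= => /andP[/eqP/pos_inj-> /eqP->]; by [].
congr (_, (_, _)); first by apply/ffunP=> i; case: (H i).
by apply/permP=> i; case: (H i).
Qed.

(** A diagram all of whose bottom points lie on through strands is given by a top
    and a middle. *)
Lemma tm_onto (y : {set block k l n}) t :
  is_diag y -> topf y = val t -> botf y =1 (fun=> None) ->
  exists h, y = tm_blocks (t, h).
Proof.
move=> yP yt yb.
have H i : {cd : 'I_l * dot k | (Some i, Some (pos t cd.1), cd.2) \in y}.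
  apply: sigW.
  have /botf_strandP-/(_ yP)[j [d yd]] : i \in strand_pts (botf y) by rewrite inE yb.
  have [c E] : exists c, j = pos t c.
    by apply: strand_pts_pos; rewrite -yt; apply/topf_strandP=> //; exists i, d.
  by exists (c, d); rewrite -E.
pose s i := (sval (H i)).1.
have sI : injective s.
  move=> i j; rewrite /s; case: (H i) (H j) => [[c d] /= yc] [[c' d'] /= yc'] E.
  by move: yc'; rewrite -E => /(diag_top_uniq yP yc)[[]].
pose h : wreath k l := ([ffun i => (sval (H i)).2], perm sI).
have Hh i : (Some i, Some (pos t (h.2 i)), h.1 i) \in y.
  by rewrite permE ffunE /s; case: (H i).
exists h; apply/setP=> -[[[i|] [j|]] d].
- rewrite mem_tm_strand; apply/idP/andP => [yd|[/eqP-> /eqP->] //].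
  by have [[->] ->] := diag_bot_uniq yP yd (Hh i).
- by rewrite mem_tm_bot mem_botf // yb.
- by rewrite mem_tm_top mem_topf // yt.
- by rewrite mem_tm_bot diag_nonempty.
Qed.

Lemma tm_strands t h : #|strands (tm_blocks (t, h))| = l.
Proof. by rewrite -card_strand_pts_topf ?tm_is_diag // topf_tm card_strand_pts_half. Qed.

End Halves.

(** * Diagrams with a given number of through strands *)

Section Cells.
Variables (k r n l : nat).
Implicit Types (t b : half k n l) (h : wreath k l) (x : diag k n).

(** The diagram with top t, middle h and bottom b. *)
Definition mk_diag t h b : diag k n :=
  Diag (bcomp_is_diag r (tm_is_diag t h) (flip_is_diag (tm_is_diag b (wone k l)))).

Lemma mem_mk_strand t h b i j d :
  reflect (exists c, [/\ i = pos b c, j = pos t (h.2 c) & d = h.1 c])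
          ((Some i, Some j, d) \in blocks (mk_diag t h b)).
Proof.
apply: (iffP (mem_bcomp_strand _ _ _ _ _ _)).
  move=> [c [d1 [d2 []]]]; rewrite mem_flip !mem_tm_strand /= perm1 ffunE.
  by move=> /andP[/eqP-> /eqP->] /andP[/eqP-> /eqP->] ->; exists c; rewrite dadd0l.
move=> [c [-> -> ->]]; exists c, (dot0 k), (h.1 c).
by rewrite mem_flip !mem_tm_strand dadd0l /= perm1 ffunE !eqxx.
Qed.

Lemma mem_mk_top t h b j d :
  ((None, Some j, d) \in blocks (mk_diag t h b)) = (val t j == Some d).
Proof.
rewrite mem_bcomp /= mem_tm_top; case: eqP => //= _.
apply/existsP=> -[c /existsP[d1 /existsP[d2 /and3P[]]]].
by rewrite mem_flip mem_tm_bot.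
Qed.

Lemma mem_mk_bot t h b i d :
  ((Some i, None, d) \in blocks (mk_diag t h b)) = (val b i == Some d).
Proof.
rewrite mem_bcomp /= mem_flip mem_tm_top; case: eqP => //= _.
apply/existsP=> -[c /existsP[d1 /existsP[d2 /and3P[]]]].
by rewrite mem_tm_bot.
Qed.

Lemma dtop_mk t h b : dtop (mk_diag t h b) = val t.
Proof.
apply/ffunP=> j; rewrite ffunE; case: pickP => [d|tN].
  by rewrite mem_mk_top => /eqP.
case tj: (val t j) => [e|//].
by have := tN e; rewrite mem_mk_top tj eqxx.
Qed.

Lemma dbot_mk t h b : dbot (mk_diag t h b) = val b.
Proof.
apply/ffunP=> j; rewrite ffunE; case: pickP => [d|tN].
  by rewrite mem_mk_bot => /eqP.
case tj: (val b j) => [e|//].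
by have := tN e; rewrite mem_mk_bot tj eqxx.
Qed.

Lemma throughE x : through x = #|strands (blocks x)|.
Proof. by []. Qed.

Lemma through_mk t h b : through (mk_diag t h b) = l.
Proof.
rewrite throughE -card_strand_pts_topf ?blocks_is_diag //.
by rewrite [topf _]dtop_mk card_strand_pts_half.
Qed.

Lemma mk_comp_tm t h b t' : strand_pts (val b) = strand_pts (val t') ->
  bcomp r (blocks (mk_diag t h b)) (tm_blocks (t', wone k l)) = tm_blocks (t, h).
Proof.
move=> /eq_pos E; apply/setP=> -[[[i|] [j|]] d]; last first.
- by rewrite mem_tm_bot diag_nonempty // bcomp_is_diag ?tm_is_diag ?blocks_is_diag.
- rewrite mem_bcomp /= mem_tm_top mem_mk_top; case: eqP => //= _.
  apply/existsP=> -[q /existsP[d1 /existsP[d2 /and3P[]]]].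
  rewrite mem_tm_top => /eqP tq /mem_mk_strand[c [qc _ _]].
  by have := pos_strand t' c; rewrite -E -qc inE tq.
- rewrite mem_bcomp /= !mem_tm_bot.
  apply/existsP=> -[q /existsP[d1 /existsP[d2 /and3P[]]]].
  rewrite mem_tm_strand mem_mk_bot /= => /andP[/eqP-> _] /eqP bq _.
  by have := pos_strand b ((wone k l).2 i); rewrite E inE bq.
rewrite mem_tm_strand; apply/mem_bcomp_strand/andP.
  move=> [q [d1 [d2 []]]]; rewrite mem_tm_strand /= perm1 ffunE => /andP[/eqP-> /eqP->].
  move=> /mem_mk_strand[c [/eqP]]; rewrite E (inj_eq (@pos_inj _ _ _ _)).
  by move=> /eqP-> -> -> ->; rewrite dadd0l.
move=> [/eqP-> /eqP->]; exists (pos t' i), (dot0 k), (h.1 i).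
rewrite mem_tm_strand /= perm1 ffunE dadd0l !eqxx; split=> //.
by apply/mem_mk_strand; exists i; rewrite E.
Qed.

(** The trivial middle gives an idempotent up to a scalar, so that an entry of the
    Gram matrix is nonzero as soon as the sandwich form is. *)
Lemma mk_idem t b : strand_pts (val t) = strand_pts (val b) ->
  diag_comp r (mk_diag t (wone k l) b) (mk_diag t (wone k l) b) =
  mk_diag t (wone k l) b.
Proof.
move=> /eq_pos E; set e := mk_diag _ _ _; apply/val_inj.
change (bcomp r (blocks e) (blocks e) = blocks e).
apply/setP=> -[[[i|] [j|]] d]; last first.
- have eP := blocks_is_diag e.
  by rewrite (diag_nonempty eP) (diag_nonempty (bcomp_is_diag r eP eP)).
- rewrite mem_bcomp /= mem_mk_top; case: eqP => //= _.
  apply/existsP=> -[q /existsP[d1 /existsP[d2 /and3P[]]]].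
  rewrite mem_mk_top => /eqP tq /mem_mk_strand[c [qc _ _]].
  by have := pos_strand t c; rewrite E -qc inE tq.
- rewrite mem_bcomp /= mem_mk_bot; case: eqP => //= _.
  apply/existsP=> -[q /existsP[d1 /existsP[d2 /and3P[]]]].
  rewrite mem_mk_bot => /mem_mk_strand[c [_ qc _]] /eqP bq.
  by have := pos_strand b c; rewrite -E inE; rewrite /= perm1 in qc; rewrite -qc bq.
apply/mem_bcomp_strand/mem_mk_strand.
  move=> [q [d1 [d2 [/mem_mk_strand[c [-> -> ->]] /mem_mk_strand[c' [/eqP]]]]]].
  rewrite E (inj_eq (@pos_inj _ _ _ _)) /= !perm1 !ffunE => /eqP-> -> -> ->.
  by exists c'; rewrite perm1 ffunE dadd0l.
move=> [c [-> -> ->]]; exists (pos t c), (dot0 k), (dot0 k).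
rewrite /= perm1 ffunE dadd0l; split=> //; apply/mem_mk_strand; exists c;
  by rewrite /= perm1 ffunE // E.
Qed.

(** ** Every diagram with l through strands acts on tops through its bottom *)

Section OneDiagram.
Variable x : diag k n.
Hypothesis xl : through x = l.

Lemma card_dtop : #|[set j | dtop x j == None]| == l.
Proof.
by apply/eqP; rewrite -[RHS]xl; apply: card_strand_pts_topf (blocks_is_diag x).
Qed.

Lemma card_dbot : #|[set j | dbot x j == None]| == l.
Proof.
by apply/eqP; rewrite -[RHS]xl; apply: card_strand_pts_botf (blocks_is_diag x).
Qed.

(** The top and the bottom of x as indices of cells. *)
Definition diag_top : half k n l := exist _ (dtop x) card_dtop.
Definition diag_bot : half k n l := exist _ (dbot x) card_dbot.

Lemma comp_tm_match t h th : bcomp r (blocks x) (tm_blocks (t, h)) = tm_blocks th ->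
  strand_pts (val diag_bot) = strand_pts (val t).
Proof.
case: th => t' h' E.
have := @strands_match _ r _ _ _ _ _ (blocks_is_diag x) (tm_is_diag t h) l xl.
by rewrite E !tm_strands topf_tm; apply.
Qed.

(** The middle produced by x on a top whose through strands meet those of x does not
    depend on this top. *)
Lemma comp_tmP : exists h, forall t, strand_pts (val diag_bot) = strand_pts (val t) ->
  bcomp r (blocks x) (tm_blocks (t, wone k l)) = tm_blocks (diag_top, h).
Proof.
have xP := blocks_is_diag x.
(* As the through strands of t meet those of x, no bottom block of x is used: the
   composite does not depend on the dots of t. *)
have top t j d : strand_pts (val diag_bot) = strand_pts (val t) ->
    ((None, Some j, d) \in bcomp r (blocks x) (tm_blocks (t, wone k l))) =
    ((None, Some j, d) \in blocks x).
  move=> E; rewrite mem_bcomp /=; case: (_ \in blocks x) => //=.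
  apply/existsP=> -[q /existsP[d1 /existsP[d2 /and3P[]]]].
  rewrite mem_tm_top => /eqP tq xq.
  have : q \in strand_pts (val diag_bot) by apply/(botf_strandP xP); exists j, d2.
  by rewrite E inE tq.
have bot t i d : strand_pts (val diag_bot) = strand_pts (val t) ->
    ((Some i, None, d) \in bcomp r (blocks x) (tm_blocks (t, wone k l))) = false.
  move=> E; rewrite mem_bcomp /= mem_tm_bot /=.
  apply/existsP=> -[q /existsP[d1 /existsP[d2 /and3P[]]]].
  rewrite mem_tm_strand => /andP[/eqP-> _]; rewrite (mem_botf xP) => /eqP bq _.
  by have := pos_strand t ((wone k l).2 i); rewrite -E inE [dbot _ _]bq.
have yP t : is_diag (bcomp r (blocks x) (tm_blocks (t, wone k l))).
  by rewrite bcomp_is_diag ?tm_is_diag.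
have [|i|h Eh] := tm_onto (t := diag_top) (yP diag_bot).
- by apply/ffunP=> j; rewrite !ffunE; apply: eq_pick => d; rewrite top.
- by rewrite ffunE; case: pickP => // d; rewrite bot.
exists h => t E; rewrite -Eh; apply/setP=> -[[[i|] [j|]] d].
- apply/mem_bcomp_strand/mem_bcomp_strand=> -[q [d1 [d2 []]]].
    rewrite mem_tm_strand -(eq_pos E) => yq xq ->; exists q, d1, d2.
    by rewrite mem_tm_strand.
  rewrite mem_tm_strand (eq_pos E) => yq xq ->; exists q, d1, d2.
  by rewrite mem_tm_strand.
- by rewrite !bot.
- by rewrite !top.
- by rewrite !diag_nonempty.
Qed.

End OneDiagram.

End Cells.

(** * Modules over an algebra with monomial structure constants *)

Section BasedModules.
Variables (F : fieldType) (B : finType) (one : B) (comp : B -> B -> F * B).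

Lemma bvecE (x z : B) : bvec F x z = (z == x)%:R.
Proof. by rewrite ffunE. Qed.

Lemma balg_sum (u : balg F B) : u = \sum_x u x *: bvec F x.
Proof.
apply/ffunP=> z; rewrite sum_ffunE (bigD1 z) //= big1 => [|x xz].
  by rewrite !ffunE eqxx addr0 [_ *: _]mulr1.
by rewrite !ffunE eq_sym (negPf xz) scaler0.
Qed.

Lemma bmul_bvec x y : bmul comp (bvec F x) (bvec F y) =
  (comp x y).1 *: bvec F (comp x y).2.
Proof.
rewrite /bmul (bigD1 x) //= [X in _ + X]big1 ?addr0 => [|x' xx']; last first.
  by rewrite big1 // => y' _; rewrite !ffunE (negPf xx') !mul0r scale0r.
rewrite (bigD1 y) //= big1 ?addr0 => [|y' yy']; last first.
  by rewrite !ffunE (negPf yy') mulr0 mul0r scale0r.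
by rewrite !ffunE !eqxx !mul1r.
Qed.

Variables (V : vectType F) (rV : bmodule one comp V).

Lemma bact_bvecM x y v :
  rV (bvec F x) (rV (bvec F y) v) = (comp x y).1 *: rV (bvec F (comp x y).2) v.
Proof.
by rewrite -comp_lfunE -bactM bmul_bvec linearZ scale_lfunE.
Qed.

Lemma bsubmodule_basis (U : {vspace V}) :
  (forall x v, v \in U -> rV (bvec F x) v \in U) -> bsubmodule rV U.
Proof.
move=> H u; apply/subvP=> _ /memv_imgP[v vU ->].
rewrite [u]balg_sum linear_sum sum_lfunE memv_suml // => x _.
by rewrite linearZ scale_lfunE memvZ ?H.
Qed.

End BasedModules.

(** Schur's lemma for commuting actions: an eigenspace of one of the basis elements
    is a submodule, so that each of them acts by a scalar. *)
Lemma bsimple_comm_dim1 (F : closedFieldType) (B : finType) (one : B)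
    (comp : B -> B -> F * B) (V : vectType F) (rV : bmodule one comp V) :
  (forall x y, comp x y = comp y x) -> bsimple rV -> \dim {:V} = 1%N.
Proof.
move=> compC [/eqP dV simpleV].
have scal x : exists a, forall v, rV (bvec F x) v = a *: v.
  pose f := rV (bvec F x); pose A := passmx.mxof (vbasis {:V}) (vbasis {:V}) f.
  have [a Aa] : exists a, eigenvalue A a.
    have /closed_rootP[a Aa] : size (char_poly A) != 1%N.
      by rewrite size_char_poly eqSS; move: dV; rewrite dimvf.
    by exists a; rewrite eigenvalue_root_char.
  have fa : passmx.leigenspace f a != 0%VS.
    have vb := vbasisP {:V}.
    by rewrite (passmx.leigenspaceE vb) (passmx.vsof_eq0 vb).
  have [|E|E] := simpleV (passmx.leigenspace f a).
  - apply: bsubmodule_basis => y v; rewrite !memv_ker !add_lfunE !opp_lfunE.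
    rewrite !scale_lfunE !id_lfunE !subr_eq0 => /eqP E.
    rewrite /f bact_bvecM compC -bact_bvecM.
    by rewrite -/f E linearZ.
  - by rewrite E eqxx in fa.
  exists a => v; have : v \in passmx.leigenspace f a by rewrite E memvf.
  by rewrite memv_ker add_lfunE opp_lfunE scale_lfunE id_lfunE subr_eq0 => /eqP.
have [v vf v0] : exists2 v, v \in {:V} & v != 0.
  by exists (vpick {:V}); rewrite ?memv_pick // vpick0 -dimv_eq0.
have [|E|<-] := simpleV <[v]>%VS; last by rewrite dim_vline v0.
  apply: bsubmodule_basis => x w /vlineP[c ->]; have [a ->] := scal x.
  by rewrite !memvZ // memv_line.
by have := memv_line v; rewrite E memv0 (negPf v0).
Qed.

(** * The pairing of tops and bottoms *)

Section Gram.
Variables (F : fieldType) (r : nat) (pa pb pg : {poly F}) (n l : nat).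
Local Notation k := (Kpred r pa).
Implicit Types (t b : half k n l) (x : diag k n).

(** The value of the closed components formed by the bottom b on top of the top t. *)
Definition closed_pairing (b t : {ffun 'I_n -> option (dot k)}) : F :=
  \prod_q (if (t q, b q) is (Some d, Some e) then closed_value pb pg (dadd r d e)
           else 1).

Lemma closed_scalarE m p (x : {set block k n p}) (y : {set block k m n}) :
  is_diag x -> is_diag y ->
  closed_scalar pb pg x y = closed_pairing (botf x) (topf y).
Proof.
move=> xP yP; apply: eq_bigr => q _.
have E d : \prod_(e : dot k | (Some q, None, e) \in x) closed_value pb pg (dadd r d e)
  = if botf x q is Some e then closed_value pb pg (dadd r d e) else 1.
  under eq_bigl => e do rewrite mem_botf //.
  case: (botf x q) => [e|]; last by rewrite big1 // => e; case: eqP.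
  by under eq_bigl => e' do rewrite eq_sym; rewrite big_pred1_eq.
under eq_bigr => d _ do rewrite E.
under eq_bigl => d do rewrite mem_topf //.
case: (topf y q) => [d|]; last by rewrite big_pred0.
by under eq_bigl => d' do rewrite eq_sym; rewrite big_pred1_eq.
Qed.

(** The sandwich form: b on top of t loses no through strand exactly when their
    through strands meet, and the middle created by composing is then trivial. *)
Definition cell_form t b : F :=
  if strand_pts (val b) == strand_pts (val t) then closed_pairing (val b) (val t)
  else 0.

Lemma sq_coefE (e : diag k n) : sq_coef pb pg e =
  if e == diag_comp r e e then closed_pairing (dbot e) (dtop e) else 0.
Proof.
rewrite /sq_coef bmul_bvec ffunE bvecE /= closed_scalarE ?blocks_is_diag //.
by case: ifP => _; [rewrite [_ *: _]mulr1|rewrite scaler0].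
Qed.

Lemma pseudo_idemE (e : diag k n) : diag_comp r e e = e ->
  pseudo_idem pb pg e = (closed_pairing (dbot e) (dtop e) != 0).
Proof.
move=> ee; rewrite /pseudo_idem sq_coefE ee eqxx bmul_bvec /mro_comp ee /=.
by rewrite closed_scalarE ?blocks_is_diag // eqxx.
Qed.

Lemma gram_entryE t b : gram_entry pb pg t b = cell_form t b.
Proof.
rewrite /gram_entry /cell_form; case: pickP => [e|none].
  move=> /and4P[/eqP el /eqP et /eqP eb /andP[_]]; rewrite sq_coefE eb et.
  case: (e =P _) => [ee _|_]; last by rewrite eqxx.
  have := strands_match (r := r) (blocks_is_diag e) (blocks_is_diag e) el el.
  rewrite -[bcomp _ _ _]/(blocks (diag_comp r e e)) -ee => /(_ el) E.
  by rewrite -et -eb [strand_pts (dbot e)]E eqxx.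
case: eqP => // E.
have := none (mk_diag r t (wone k l) b).
rewrite through_mk pseudo_idemE ?mk_idem // dtop_mk dbot_mk !eqxx /=.
by move=> /negbFE/eqP.
Qed.

(** ** The action on the cell module *)

Variable V : vectType F.

Lemma pure_is_linear (q : topmid r pa n l) :
  linear (pure q : V -> cellV r pa n l V).
Proof.
move=> a u v; apply/ffunP=> q'; rewrite !ffunE.
by case: eqP; rewrite // scaler0 addr0.
Qed.
HB.instance Definition _ q := GRing.isLinear.Build F V (cellV r pa n l V) _ (pure q)
  (pure_is_linear q).

(** The tensor product over the sandwiched algebra is identified with the functions
    from tops to V, by putting the trivial middle everywhere. *)
Definition top_tensor (w : {ffun half k n l -> V}) : cellV r pa n l V :=
  \sum_t pure (t, wone k l) (w t).

Lemma top_tensor_is_linear : linear top_tensor.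
Proof.
move=> a u v; rewrite scaler_sumr -big_split; apply: eq_bigr => t _ /=.
by rewrite !ffunE linearP.
Qed.
HB.instance Definition _ := GRing.isLinear.Build F {ffun half k n l -> V}
  (cellV r pa n l V) _ top_tensor top_tensor_is_linear.

Lemma top_tensorE w t h :
  top_tensor w (t, h) = if h == wone k l then w t else 0.
Proof.
rewrite sum_ffunE (bigD1 t) //= big1 ?addr0 ?ffunE ?xpair_eqE ?eqxx //.
by move=> t' tt'; rewrite ffunE xpair_eqE eq_sym (negPf tt').
Qed.

Lemma cell_act_top_tensor x t0 h0 b w :
  through x = l -> dbot x = val b ->
  (forall t, strand_pts (val b) = strand_pts (val t) ->
     bcomp r (blocks x) (tm_blocks (t, wone k l)) = tm_blocks (t0, h0)) ->
  cell_act pb pg x (top_tensor w) = pure (t0, h0) (\sum_t cell_form t b *: w t).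
Proof.
move=> xl xb Eh.
rewrite /cell_act (eq_bigr (fun q => \sum_(q' : topmid r pa n l | (q.2 == wone k l) &&
   (tm_blocks q' == bcomp r (blocks x) (tm_blocks q)))
     pure q' (closed_scalar pb pg (blocks x) (tm_blocks q) *: w q.1))); last first.
  move=> [t h'] _; rewrite top_tensorE /=; case: eqP => [->|_] /=.
    by rewrite scaler_sumr; apply: eq_bigr => q' _; rewrite linearZ.
  by rewrite big_pred0_eq big1 ?scaler0 // => q' _; rewrite linear0.
(* Only the terms with a trivial middle h' survive. *)
rewrite -(pair_bigA _ (fun t h' => \sum_(q' : topmid r pa n l | (h' == wone k l) &&
   (tm_blocks q' == bcomp r (blocks x) (tm_blocks (t, h'))))
     pure q' (closed_scalar pb pg (blocks x) (tm_blocks (t, h')) *: w t))) /=.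
rewrite linear_sum; apply: eq_bigr => t _ /=.
rewrite (bigD1 (wone k l)) //= [X in _ + X]big1 ?addr0 => [|h' /negPf->]; last first.
  by rewrite big_pred0_eq.
rewrite eqxx /= closed_scalarE ?tm_is_diag ?blocks_is_diag // topf_tm [botf _]xb.
rewrite /cell_form.
case: eqP => [E|NE].
  rewrite (Eh _ E); under eq_bigl do rewrite (inj_eq (@tm_blocks_inj _ _ _)).
  by rewrite big_pred1_eq.
rewrite scale0r linear0 big_pred0 // => q'; apply/eqP => Eq'.
by apply: NE; rewrite -xb; apply: (comp_tm_match xl (esym Eq')).
Qed.

End Gram.

(** * Linear algebra *)

Lemma memv_bigcapP (F : fieldType) (V : vectType F) (I : finType) (P : pred I)
    (Us : I -> {vspace V}) (v : V) :
  reflect (forall i, P i -> v \in Us i) (v \in (\bigcap_(i | P i) Us i)%VS).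
Proof. by rewrite memvE; apply: (iffP subv_bigcapP) => H i /H; rewrite memvE. Qed.

(** The quotient of V^I by the common kernel of the linear forms given by the
    columns of M. *)
Lemma dim_quotient_rank (F : fieldType) (I : finType) (V L : vectType F)
    (M : 'M[F]_#|I|) (g : 'Hom({ffun I -> V}, L)) :
  limg g = fullv ->
  (forall w, g w = 0 <-> forall j, \sum_i M i j *: w (enum_val i) = 0) ->
  \dim {:L} = (\rank M * \dim {:V})%N.
Proof.
move=> g_onto kerg.
(* With M = C R, C of full column rank and R of full row rank, the forms given by
   the columns of C have the same common kernel, and are independent. *)
pose C := col_base M; pose R := row_base M.
have /row_fullP[C' C'C] : row_full C := col_base_full M.
have /row_freeP[R' RR'] : row_free R := row_base_free M.
pose psi (w : {ffun I -> V}) : {ffun 'I_(\rank M) -> V} :=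
  [ffun c => \sum_i C i c *: w (enum_val i)].
have psi_lin : linear psi.
  move=> a u v; apply/ffunP=> c; rewrite !ffunE scaler_sumr -big_split.
  apply: eq_bigr => i _ /=.
  by rewrite !ffunE scalerDr scalerA mulrC -scalerA.
pose psi' : {linear _ -> _} := HB.pack psi (GRing.isLinear.Build _ _ _ _ psi psi_lin).
pose h := linfun psi'.
have hE w : h w = psi w by rewrite lfunE.
have kerE : lker h = lker g.
  apply/vspaceP=> w; rewrite !memv_ker hE; apply/eqP/eqP => [psi0|/kerg M0].
    apply/kerg => j; rewrite -(mulmx_base M).
    transitivity (\sum_c R c j *: psi w c); last first.
      by rewrite psi0 big1 // => c _; rewrite ffunE scaler0.
    under eq_bigr => i _ do rewrite mxE scaler_suml.
    rewrite exchange_big; apply: eq_bigr => c _ /=; rewrite ffunE scaler_sumr.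
    by apply: eq_bigr => i _; rewrite scalerA mulrC.
  apply/ffunP=> c; rewrite !ffunE.
  transitivity (\sum_j R' j c *: \sum_i M i j *: w (enum_val i)); last first.
    by rewrite big1 // => j _; rewrite M0 scaler0.
  under [RHS]eq_bigr => j _ do rewrite scaler_sumr.
  rewrite exchange_big; apply: eq_bigr => i _ /=.
  under eq_bigr => j _ do rewrite scalerA mulrC.
  rewrite -scaler_suml; congr (_ *: _).
  have -> : C = M *m R' by rewrite -[X in X *m R'](mulmx_base M) -mulmxA RR' mulmx1.
  by rewrite mxE.
have h_onto : limg h = fullv.
  apply/eqP; rewrite eqEsubv subvf; apply/subvP=> z _.
  pose w : {ffun I -> V} := [ffun t => \sum_c C' c (enum_rank t) *: z c].
  apply/memv_imgP; exists w; rewrite ?memvf // hE; apply/ffunP=> c.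
  rewrite ffunE; under eq_bigr => i _ do rewrite ffunE enum_valK scaler_sumr.
  rewrite exchange_big (bigD1 c) //= [X in _ + X]big1 ?addr0.
    under eq_bigr => i _ do rewrite scalerA mulrC.
    rewrite -scaler_suml; have := congr1 (fun A : 'M_ _ => A c c) C'C.
    by rewrite !mxE eqxx => ->; rewrite scale1r.
  move=> c' cc'; under eq_bigr => i _ do rewrite scalerA mulrC.
  rewrite -scaler_suml; have := congr1 (fun A : 'M_ _ => A c' c) C'C.
  by rewrite !mxE (negPf cc') => ->; rewrite scale0r.
have := limg_ker_dim h fullv; rewrite h_onto kerE -(limg_ker_dim g fullv) g_onto.
by move/addnI => <-; rewrite !dimvf /= /dim /= card_ord.
Qed.

(** * The simple quotient *)

Section SimpleQuotient.
Variables (F : fieldType) (r : nat) (pa pb pg : {poly F}) (n l : nat).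
Local Notation k := (Kpred r pa).
Variables (V : vectType F) (rV : sandwich_module r pa l V).
Variables (L : vectType F) (rL : mro_module r pa pb pg n L).
Hypotheses (V_simple : bsimple rV) (L_simple : bsimple rL) (L_apex : has_apex rL l).
Variable f : 'Hom(cellV r pa n l V, L).
Hypothesis f_onto : cell_onto rV rL f.

Lemma wmul1 (h : wreath k l) : wmul r (wone k l) h = h.
Proof.
case: h => d s; rewrite /wmul /= mulg1; congr pair.
by apply/ffunP=> i; rewrite !ffunE dadd0r.
Qed.

Lemma onto_pure t h v :
  f (pure (t, h) v) = f (pure (t, wone k l) (rV (bvec F h) v)).
Proof. by case: f_onto => bal _ _; rewrite -bal /tm_right /= wmul1. Qed.

(** The map from the tensor product over the sandwiched algebra onto L. *)
Definition onto_top : 'Hom({ffun half k n l -> V}, L) :=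
  (f \o linfun (@top_tensor F r pa n l V))%VF.

Lemma onto_topE w : onto_top w = f (top_tensor w).
Proof. by rewrite comp_lfunE lfunE. Qed.

Lemma onto_top_full : limg onto_top = fullv.
Proof.
have [_ _ full] := f_onto.
apply/eqP; rewrite eqEsubv subvf -full; apply/subvP=> _ /memv_imgP[c _ ->].
pose w : {ffun half k n l -> V} := [ffun t => \sum_h rV (bvec F h) (c (t, h))].
apply/memv_imgP; exists w; rewrite ?memvf // onto_topE.
have -> : c = \sum_q pure q (c q).
  apply/ffunP=> q; rewrite sum_ffunE (bigD1 q) //= ffunE eqxx big1 ?addr0 // => q' qq'.
  by rewrite ffunE eq_sym (negPf qq').
transitivity (\sum_t \sum_h f (pure (t, h) (c (t, h)))).
  by rewrite pair_bigA linear_sum; apply: eq_bigr => -[].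
rewrite linear_sum; apply: eq_bigr => t _.
rewrite ffunE !linear_sum; apply: eq_bigr => h _.
exact: onto_pure.
Qed.

(** By minimality of the apex, the vectors killed by all diagrams with l through
    strands form a submodule. *)
Lemma apex_faithful (y : L) :
  (forall x, through x = l -> rL (bvec F x) y = 0) -> y = 0.
Proof.
move=> y0.
pose U := (\bigcap_(x : diag k n | through x == l) lker (rL (bvec F x)))%VS.
have UP z : z \in U -> forall x, through x = l -> rL (bvec F x) z = 0.
  by move=> /memv_bigcapP H x /eqP/H; rewrite memv_ker => /eqP.
have [nann lower] := L_apex.
have subU : bsubmodule rL U.
  apply: bsubmodule_basis => x z /UP zU; apply/memv_bigcapP => x' /eqP x'l.
  rewrite memv_ker bact_bvecM /=; apply/eqP.
  have : (through (diag_comp r x' x) <= l)%N.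
    by rewrite -x'l !throughE strands_bcomp_le ?blocks_is_diag.
  rewrite leq_eqVlt => /orP[/eqP/zU->|lt]; first by rewrite scaler0.
  rewrite (lower _ lt) ?lfunE /= ?scaler0 // => u.
  by rewrite bvecE; case: (u =P _) => [->|]; rewrite ?eqxx.
have yU : y \in U by apply/memv_bigcapP => x /eqP /y0; rewrite memv_ker => ->.
have [_ simp] := L_simple; have [E|E] := simp U subU.
  by move: yU; rewrite E memv0 => /eqP.
case: nann => u ul; apply/lfunP=> z; rewrite zero_lfunE [u]balg_sum linear_sum sum_lfunE.
apply: big1 => x _; rewrite linearZ scale_lfunE.
have [->|ux] := eqVneq (u x) 0; first by rewrite scale0r.
by rewrite UP ?scaler0 ?ul // E memvf.
Qed.

(** Since V is simple, no nonzero vector of V is lost in L. *)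
Lemma pure_faithful (v : V) :
  (forall t h, f (pure (t, wone k l) (rV (bvec F h) v)) = 0) -> v = 0.
Proof.
move=> v0.
pose U := (\bigcap_(q : topmid r pa n l)
  lker (f \o linfun (@pure F r pa n l V (q.1, wone k l)) \o rV (bvec F q.2)))%VS.
have UP z : z \in U <-> forall t h, f (pure (t, wone k l) (rV (bvec F h) z)) = 0.
  split=> [/memv_bigcapP H t h|H].
    by have := H (t, h) isT; rewrite memv_ker !comp_lfunE lfunE => /eqP.
  by apply/memv_bigcapP => -[t h] _; rewrite memv_ker !comp_lfunE lfunE H.
have subU : bsubmodule rV U.
  apply: bsubmodule_basis => h z /UP zU; apply/UP => t h'.
  by rewrite bact_bvecM scale1r zU.
have [_ simp] := V_simple; have [E|E] := simp U subU.
  by move: v0 => /UP; rewrite E memv0 => /eqP.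
have [L0 _] := L_simple; case: L0; apply/eqP; rewrite dimv_eq0 -onto_top_full.
rewrite -subv0; apply/subvP=> _ /memv_imgP[w _ ->].
rewrite onto_topE linear_sum memv0 big1 // => t _.
have /UP/(_ t (wone k l)) : w t \in U by rewrite E memvf.
by rewrite bact1 id_lfunE.
Qed.

Lemma onto_top_ker w :
  onto_top w = 0 <-> forall b, \sum_t cell_form pb pg t b *: w t = 0.
Proof.
have [_ equi _] := f_onto; rewrite onto_topE; split=> [w0 b|w0].
  apply: pure_faithful => t h; rewrite -onto_pure.
  rewrite -(@cell_act_top_tensor _ _ _ _ _ _ _ _ (mk_diag r t h b))
    ?through_mk ?dbot_mk //.
    by rewrite equi w0 linear0.
  by move=> t' E; rewrite mk_comp_tm.
apply: apex_faithful => x xl; have [h Eh] := comp_tmP r xl.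
by rewrite -equi (cell_act_top_tensor pb pg w xl _ Eh) // w0 !linear0.
Qed.

Lemma dim_simple_quotient : \dim {:L} = (\rank (gram r pa pb pg n l) * \dim {:V})%N.
Proof.
apply: dim_quotient_rank onto_top_full _ => w.
have E j : \sum_i gram r pa pb pg n l i j *: w (enum_val i) =
    \sum_t cell_form pb pg t (enum_val j) *: w t.
  rewrite [RHS](reindex _ (onW_bij _ (@enum_val_bij _))); apply: eq_bigr => i _.
  by rewrite mxE gram_entryE.
split=> [/onto_top_ker w0 j|w0]; first by rewrite E w0.
by apply/onto_top_ker => b; rewrite -[b]enum_rankK -E w0.
Qed.

End SimpleQuotient.

Lemma wr_comp_comm (F : fieldType) (r : nat) (pa : {poly F}) (l : nat) :
  (l <= 1)%N -> forall h h' : wreath (Kpred r pa) l, wr_comp h h' = wr_comp h' h.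
Proof.
move=> l1 h h'; have eq_ord (i j : 'I_l) : i = j.
  have ord_0 (q : 'I_l) : q = 0%N :> nat.
    by apply/eqP; rewrite -leqn0 -ltnS (leq_trans (ltn_ord q)).
  by apply/ord_inj; rewrite !ord_0.
congr (_, (_, _)); last by apply/permP=> i; apply: eq_ord.
by apply/ffunP=> i; rewrite !ffunE daddC (eq_ord (h'.2 i) i) (eq_ord (h.2 i) i).
Qed.

Theorem theorem6p0p5 (F : closedFieldType) (r : nat) (pa pb pg : {poly F})
  (n lam : nat)
  (r_odd : odd r)
  (deg_pb : ((size pb).-1 < (Kpred r pa).+1)%N)
  (deg_pg : ((size pg).-1 < (Kpred r pa).+1)%N)
  (charF : forall p, p \in [pchar F] -> ~~ (p %| 2)%N && ~~ (p %| r)%N)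
  (lam_apex : is_apex r pa pb pg n lam)
  (V : vectType F) (rV : sandwich_module r pa lam V) (V_simple : bsimple rV)
  (L : vectType F) (rL : mro_module r pa pb pg n L)
  (L_V : is_simple_quotient rV rL) :
  \dim {:L} = (\rank (gram r pa pb pg n lam) * \dim {:V})%N /\
  ((lam <= 1)%N \/ \dim {:V} = 1%N -> \dim {:L} = \rank (gram r pa pb pg n lam)).
Proof.
have [L_simple L_apex [f f_onto]] := L_V.
have dimL := dim_simple_quotient V_simple L_simple L_apex f_onto.
split=> // dimV; rewrite dimL; suff -> : \dim {:V} = 1%N by rewrite muln1.
case: dimV => // lam1.
exact: bsimple_comm_dim1 (wr_comp_comm lam1) V_simple.
Qed.
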